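(* Let $A\subseteq\mathbb{R}^n$ be a nonempty subset closed under $x\oplus y=\tfrac{x+y}{2}$, endowed with the relative Euclidean topology. Then $(A,\oplus)$ is a midpoint-convex body in the category $\mathbf{Top}$ of topological spaces and continuous maps if and only if $A$ is a bounded convex subset of $\mathbb{R}^n$.
   Context: In $\mathbf{Top}$ (products with product topology), a midpoint object is a space $A$ with continuous $m\colon A\times A\to A$ satisfying $m(x,x)=x$, $m(x,y)=m(y,x)$, $m(m(x,y),m(z,w))=m(m(x,z),m(y,w))$; it is cancellative if $m(x,y)=m(x,z)$ implies $y=z$; it is iterative if for every space $X$ and continuous $c\colon X\to A\times X$ there is a unique continuous $u\colon X\to A$ with $u=m\circ(\mathrm{id}_A\times u)\circ c$. A midpoint-convex body is a cancellative iterative midpoint object. *)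

(* Defs.v *)
From HB Require Import structures.
From mathcomp Require Import all_boot all_order all_algebra.
From mathcomp Require Import all_classical all_reals all_analysis.
From mathcomp Require Import Rstruct Rstruct_topology.
From Stdlib Require Import Rdefinitions.

Set Implicit Arguments.
Unset Strict Implicit.
Unset Printing Implicit Defensive.

Import Order.TTheory GRing.Theory Num.Theory.
Import numFieldNormedType.Exports.
Local Open Scope classical_set_scope.
Local Open Scope ring_scope.

Definition midpoint_object (T : topologicalType) (m : T -> T -> T) : Prop :=
  [/\ continuous (fun p : T * T => m p.1 p.2),
      (forall x, m x x = x),
      (forall x y, m x y = m y x) &
      (forall x y z w, m (m x y) (m z w) = m (m x z) (m y w))].

Definition mid_cancellative (T : Type) (m : T -> T -> T) : Prop :=
  forall x y z, m x y = m x z -> y = z.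

Definition mid_iterative (T : topologicalType) (m : T -> T -> T) : Prop :=
  forall (X : topologicalType) (c : X -> T * X), continuous c ->
    exists! u : X -> T,
      continuous u /\ u = (fun x => m (c x).1 (u (c x).2)).

Definition midpoint_convex_body (T : topologicalType) (m : T -> T -> T) : Prop :=
  [/\ midpoint_object m, mid_cancellative m & mid_iterative m].

Definition mid_closed (n : nat) (A : set 'rV[R]_n) : Prop :=
  forall x y, x \in A -> y \in A -> (2^-1 : R) *: (x + y) \in A.

(* The operation (+) restricted to A; [A] coerces to the subtype
   {x | x \in A}, which carries the subspace (initial) topology. *)
Definition Amid (n : nat) (A : set 'rV[R]_n) (hA : mid_closed A) (x y : A) : A :=
  SigSub (hA _ _ (proj2_sig x) (proj2_sig y)).

(* Main.v *)
(* If [A] is bounded and convex, the only possible solution of the fixed-point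
   equation is [u x = \sum_k 2^-(k+1) a (t^k x)], where [c x = (a x, t x)].  The
   series converges uniformly, so [u] is continuous.  That [u x] lies in [A],
   which need not be closed, uses finite dimension: the terms lie in the affine
   span of finitely many of them, and a small enough tail of the series can be
   absorbed into the weights of these.
   Conversely, apply iterativity to the space of sequences in [A] with the
   product topology and [c a = (a 0, shift a)], obtaining a continuous [u].  It
   sends [(p, ..., p, b, b, ...)], with [N] copies of [p], to
   [p + 2^-N (b - p)].  If [A] were unbounded, one could choose [b] depending on
   [N] so that these values stay away from [p], although the sequences converge
   to the constant sequence [p].  Once [A] is bounded, [u] sends the sequence of
   [x]s and [y]s given by the binary digits of [s] to [s x + (1 - s) y]. *)
Require Import Defs.
From HB Require Import structures.
From mathcomp Require Import all_boot all_order all_algebra.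
From mathcomp Require Import all_classical all_reals all_analysis.
From mathcomp Require Import Rstruct Rstruct_topology.
From Stdlib Require Import Rdefinitions.
From mathcomp Require Import ring lra zify.
Import Order.TTheory GRing.Theory Num.Theory.
Import numFieldNormedType.Exports.
Local Open Scope classical_set_scope.
Local Open Scope ring_scope.

(* Importing [Rdefinitions] redirects [%N] to Stdlib's [N_scope]. *)
Delimit Scope nat_scope with N.
Set Implicit Arguments.
Unset Strict Implicit.
Unset Printing Implicit Defensive.

(** * Geometric decay and halving recursions *)

Lemma expr_half_lt (K : realType) (C e : K) :
  0 <= C -> 0 < e -> exists N, 2^-1 ^+ N * C < e.
Proof.
move=> C0 e0; have Ce : 0 <= C / e by rewrite divr_ge0 // ltW.
exists (Num.bound (C / e)); set N := Num.bound _.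
have lt1 : C / e < N%:R by exact: archi_boundP.
have lt2 : N%:R < 2 ^+ N :> K by rewrite -natrX ltr_nat ltn_expl.
rewrite exprVn mulrC ltr_pdivrMr ?exprn_gt0 // mulrC -ltr_pdivrMr //.
exact: lt_trans lt2.
Qed.

(** Iterating gives [d 0 = 2^-N d N], which tends to 0. Applied to a difference, this identifies two
    bounded solutions of the same midpoint recursion. *)
Lemma half_orbit_eq0 (K : realType) (V : normedModType K) (C : K)
    (d : nat -> V) :
  (forall k, d k = 2^-1 *: d k.+1) -> (forall k, `|d k| <= C) -> d 0%N = 0.
Proof.
move=> hd hC; have C0 : 0 <= C := le_trans (normr_ge0 _) (hC 0%N).
have dE N : d 0%N = 2^-1 ^+ N *: d N.
  by elim: N => [|N ->]; rewrite ?expr0 ?scale1r // hd scalerA exprSr.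
apply/eqP/negPn/negP; rewrite -normr_gt0 => /(expr_half_lt C0)[N].
rewrite ltNge => /negP; apply; rewrite [in leLHS](dE N) normrZ.
by rewrite ger0_norm ?exprn_ge0 ?invr_ge0 // ler_wpM2l ?exprn_ge0 ?invr_ge0.
Qed.

(** The intervals centred at [s k] with radius [2^-k C] are nested, so the supremum of their left
    endpoints lies in all of them. *)
Lemma scalar_fast_limit (K : realType) (C : K) (s : nat -> K) :
  (forall k, `|s k.+1 - s k| <= 2^-1 ^+ k.+1 * C) ->
  exists l, forall k, `|s k - l| <= 2^-1 ^+ k * C.
Proof.
move=> hs.
pose lo k := s k - 2^-1 ^+ k * C; pose hi k := s k + 2^-1 ^+ k * C.
have step k : lo k <= lo k.+1 /\ hi k.+1 <= hi k.
  by have := hs k; rewrite /lo /hi ler_norml exprS; lra.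
have mono (i j : nat) : (i <= j)%N -> lo i <= lo j /\ hi j <= hi i.
  move=> /subnK <-; elim: (j - i)%N => [//|m [IH1 IH2]].
  have [h1 h2] := step (m + i)%N; rewrite addSn.
  by split; [exact: le_trans h1|exact: le_trans IH2].
have C0 k : 0 <= 2^-1 ^+ k * C.
  have := le_trans (normr_ge0 _) (hs k).
  by rewrite exprS -mulrA pmulr_rge0 // invr_gt0.
have lohi (i j : nat) : lo i <= hi j.
  have [h1 _] := mono _ _ (leq_maxl i j).
  have [_ h2] := mono _ _ (leq_maxr i j).
  have := C0 (maxn i j); move: h1 h2; rewrite /lo /hi; lra.
have hsup : has_sup (range lo).
  split; first by exists (lo 0%N), 0%N.
  by exists (hi 0%N) => _ [i _ <-].
exists (sup (range lo)) => k.
have h1 : lo k <= sup (range lo) by apply: ub_le_sup; [case: hsup|exists k].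
have h2 : sup (range lo) <= hi k.
  by apply: ge_sup; [case: hsup|move=> _ [i _ <-]].
by move: h1 h2; rewrite ler_norml /lo /hi; lra.
Qed.

(** * Matrix norms and the dyadic series *)

Lemma ler_mx_norm_coord (K : realType) (m n : nat) (A : 'M[K]_(m, n)) i j :
  `|A i j| <= `|A|.
Proof.
by rewrite [leRHS]/Num.norm /= mx_normrE; apply/bigmax_geP; right; exists (i, j).
Qed.

Lemma mx_norm_le (K : realType) (m n : nat) (A : 'M[K]_(m, n)) (c : K) :
  0 <= c -> (forall i j, `|A i j| <= c) -> `|A| <= c.
Proof.
move=> c0 h; rewrite [leLHS]/Num.norm /= mx_normrE.
by apply/bigmax_leP; split => // -[i j] _; exact: h.
Qed.

Lemma mulmx_bounded (K : realType) (m n : nat) (Q : 'M[K]_(m, n)) :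
  exists2 D : K, 0 <= D & forall v : 'rV[K]_m, `|v *m Q| <= D * `|v|.
Proof.
exists (\sum_i \sum_j `|Q i j|) => [|v].
  by apply: sumr_ge0 => i _; apply: sumr_ge0.
apply: mx_norm_le => [|i j].
  by rewrite mulr_ge0 // sumr_ge0 // => k _; apply: sumr_ge0.
rewrite mxE (le_trans (ler_norm_sum _ _ _)) // mulr_suml ler_sum // => k _.
rewrite normrM mulrC ler_pM // ?ler_mx_norm_coord //.
by rewrite (bigD1 j) //= lerDl sumr_ge0.
Qed.

(** The partial sum [\sum_(k < N) 2^-(k+1) a (t^k x)], built from the head so that it obeys the
    fixed-point equation up to a shift of [N]. *)
Fixpoint half_series (K : realType) (n : nat) (X : Type)
    (a : X -> 'rV[K]_n) (t : X -> X) (N : nat) (x : X) : 'rV[K]_n :=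
  if N is N'.+1 then 2^-1 *: (a x + half_series a t N' (t x)) else 0.

Lemma half_series_step (K : realType) (n : nat) (X : Type)
    (a : X -> 'rV[K]_n) (t : X -> X) (C : K) (N : nat) (x : X) :
  (forall x, `|a x| <= C) ->
  `|half_series a t N.+1 x - half_series a t N x| <= 2^-1 ^+ N.+1 * C.
Proof.
move=> aC; elim: N x => [|N IH] x.
  rewrite /= addr0 subr0 normrZ expr1 ger0_norm ?invr_ge0 //.
  by rewrite ler_wpM2l ?invr_ge0.
have -> : half_series a t N.+2 x - half_series a t N.+1 x =
    2^-1 *: (half_series a t N.+1 (t x) - half_series a t N (t x)).
  by rewrite [in LHS]/= -scalerBr opprD addrACA subrr add0r.
rewrite normrZ ger0_norm ?invr_ge0 // [in leRHS]exprS -mulrA.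
by rewrite ler_wpM2l ?invr_ge0.
Qed.

Lemma half_series_limit (K : realType) (n : nat) (X : Type)
    (a : X -> 'rV[K]_n) (t : X -> X) (C : K) :
  (forall x, `|a x| <= C) -> 0 <= C ->
  exists l : X -> 'rV[K]_n,
    [/\ forall x, l x = 2^-1 *: (a x + l (t x)),
        forall x, `|l x| <= C &
        forall N x, `|half_series a t N x - l x| <= 2^-1 ^+ N * C].
Proof.
move=> aC C0.
have hx x : exists l, forall N, `|half_series a t N x - l| <= 2^-1 ^+ N * C.
  have hj j : exists l, forall N,
      `|half_series a t N x ord0 j - l| <= 2^-1 ^+ N * C.
    apply: scalar_fast_limit => N.
    apply: le_trans (half_series_step t N x aC).
    by have := ler_mx_norm_coord
      (half_series a t N.+1 x - half_series a t N x) ord0 j; rewrite !mxE.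
  have [l hl] := choice hj; exists (\row_j l j) => N.
  apply: mx_norm_le => [|i j]; last by rewrite ord1 !mxE.
  by rewrite mulr_ge0 // exprn_ge0 // invr_ge0.
have [l hl] := choice hx; exists l; split => [x|x|N x]; last exact: hl.
- apply/eqP; rewrite -subr_eq0 -normr_le0 leNgt; apply/negP.
  move=> /(expr_half_lt C0)[N]; apply/negP; rewrite -leNgt.
  (* The partial sums satisfy the equation exactly, so the defect of [l] consists of two
     approximation errors, each at most [2^-(N+1) C]. *)
  have -> : l x - 2^-1 *: (a x + l (t x)) =
      (2^-1 *: (half_series a t N (t x) - l (t x)))
      - (half_series a t N.+1 x - l x).
    by apply/rowP => j; rewrite /= !mxE; lra.
  apply: le_trans (ler_normB _ _) _; rewrite normrZ.
  have := hl x N.+1; have := hl (t x) N.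
  rewrite exprS (@ger0_norm _ 2^-1) ?invr_ge0 //; lra.
- by have := hl x 0%N; rewrite /= sub0r normrN expr0 mul1r.
Qed.

(** * Finite and infinite convex combinations *)

Definition unit_interval_convex (K : realType) (n : nat) (A : set 'rV[K]_n) :=
  forall (x y : 'rV[K]_n) (s : K), A x -> A y -> 0 <= s -> s <= 1 ->
    A (s *: x + (1 - s) *: y).

(** The mass missing from 1 goes to [p]. The induction splits off the last point and divides the
    remaining weights by [1 - w N]. *)
Lemma convex_subcombination (K : realType) (n : nat) (A : set 'rV[K]_n)
    (p : 'rV[K]_n) (x : nat -> 'rV[K]_n) (w : nat -> K) (N : nat) :
  unit_interval_convex A -> A p -> (forall k, A (x k)) ->
  (forall k, 0 <= w k) -> \sum_(k < N) w k <= 1 ->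
  A (p + \sum_(k < N) w k *: (x k - p)).
Proof.
move=> cA Ap Ax; elim: N w => [|N IH] w w0; first by rewrite !big_ord0 addr0.
rewrite !big_ord_recr /= => w1.
have S0 : 0 <= \sum_(k < N) w k by apply: sumr_ge0.
(* If [w N = 1], rescaling would divide by zero, but then all other weights vanish and the point is
   [x N]. *)
have [wN1|wN1] := eqVneq (w N) 1.
  have wk0 (k : 'I_N) : w k = 0.
    apply/eqP; rewrite eq_le w0 andbT.
    have : w k <= \sum_(i < N) w i.
      by rewrite (bigD1 k) //= lerDl sumr_ge0.
    by move: w1; rewrite wN1; lra.
  rewrite wN1 scale1r big1 ?add0r => [|k _]; last by rewrite wk0 scale0r.
  by rewrite addrC subrK.
have lt1 : w N < 1 by rewrite lt_neqAle wN1 /=; move: w1; lra.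
have := cA _ _ _ (Ax N) (IH (fun k => w k / (1 - w N)) _ _) (w0 N) (ltW lt1).
have -> : w N *: x N + (1 - w N) *:
    (p + \sum_(k < N) (w k / (1 - w N)) *: (x k - p)) =
    p + (\sum_(k < N) w k *: (x k - p) + w N *: (x N - p)).
  rewrite scalerDr scaler_sumr.
  under eq_bigr => k _ do rewrite scalerA mulrC divfK ?subr_eq0 1?eq_sym //.
  rewrite scalerBl scale1r scalerBr.
  by apply/rowP => j; rewrite !mxE; ring.
apply=> [k|].
  by rewrite divr_ge0 // subr_ge0 ltW.
by rewrite -mulr_suml ler_pdivrMr ?subr_gt0 //; move: w1; lra.
Qed.

(** The ranks of the initial segments are at most [n]; beyond a segment of maximal rank the span no
    longer grows. *)
Lemma rows_in_finite_span (K : realType) (n : nat) (v : nat -> 'rV[K]_n) :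
  exists M, forall k, (v k <= \matrix_(i < M) v i)%MS.
Proof.
pose B M := \matrix_(i < M) v i.
have subB M k : (k < M)%N -> (v k <= B M)%MS.
  by move=> kM; rewrite (eq_row_sub (Ordinal kM)) // rowK.
have exr : exists r, `[< exists M, \rank (B M) = r >].
  by exists (\rank (B 0%N)); apply/asboolP; exists 0%N.
have ubr r : `[< exists M, \rank (B M) = r >] -> (r <= n)%N.
  by move=> /asboolP[M <-]; exact: rank_leq_col.
case: (ex_maxnP exr ubr) => r /asboolP[M rM] maxr; exists M => k.
have BM : (B M <= B (maxn M k.+1))%MS.
  by apply/row_subP => i; rewrite rowK subB // leq_max ltn_ord.
have subk : (v k <= B (maxn M k.+1))%MS.
  by apply: subB; rewrite leq_max ltnSn orbT.
apply: submx_trans subk _.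
have := mxrank_leqif_sup BM; rewrite -/(B M) => -[le <-] //.
rewrite eqn_leq le rM maxr //; apply/asboolP; by exists (maxn M k.+1).
Qed.

Lemma midpoint_orbit_unfold (K : realType) (n : nat)
    (v f : nat -> 'rV[K]_n) (N : nat) :
  (forall k, f k = 2^-1 *: (v k + f k.+1)) ->
  f 0%N = \sum_(k < N) 2^-1 ^+ k.+1 *: v k + 2^-1 ^+ N *: f N.
Proof.
move=> hf; elim: N => [|N ->]; first by rewrite big_ord0 add0r scale1r.
by rewrite big_ord_recr /= {1}hf scalerA -exprSr scalerDr addrA.
Qed.

(* The tail of the series lies in the span of finitely many of the [v k] and
   is of order [2^-N], so it can be absorbed into the weights of these. *)
Lemma midpoint_orbit_finite_sum (K : realType) (n : nat) (C : K)
    (v f : nat -> 'rV[K]_n) :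
  (forall k, f k = 2^-1 *: (v k + f k.+1)) -> (forall k, `|f k| <= C) ->
  exists (N : nat) (w : nat -> K), [/\ forall k, 0 <= w k,
    \sum_(k < N) w k <= 2 & f 0%N = \sum_(k < N) w k *: v k].
Proof.
move=> hf fC; have [M spanM] := rows_in_finite_span v.
pose B := \matrix_(i < M) v i.
have C0 : 0 <= C := le_trans (normr_ge0 _) (fC 0%N).
have fB k : (f k <= B)%MS.
  (* Modulo the row space of [B] every [v k] vanishes, so the products [f k *m cokermx B] form a
     bounded halving orbit. *)
  rewrite submxE; apply/eqP.
  have [D D0 hD] := mulmx_bounded (cokermx B).
  have := @half_orbit_eq0 K _ (D * C) (fun i => f (k + i)%N *m cokermx B).
  rewrite addn0; apply=> i; last by rewrite (le_trans (hD _)) // ler_wpM2l.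
  rewrite hf -scalemxAl mulmxDl addnS.
  by have := spanM (k + i)%N; rewrite submxE => /eqP ->; rewrite add0r.
have [D D0 hD] := mulmx_bounded (pinvmx B).
(* Here [D * C] will bound each coefficient of the tail, and [M * (D * C)] their sum. *)
have [m hm] := @expr_half_lt _ (M%:R * (D * C) + D * C) 1 
   (addr_ge0 (mulr_ge0 (ler0n _ _) (mulr_ge0 D0 C0)) (mulr_ge0 D0 C0)) ltr01.
(* The row [c] expresses [f N] through the rows of [B]; [c'] pads it with zeros from index [M]
   on. *)
pose N := (M + m)%N; pose c := f N *m pinvmx B.
pose c' (k : nat) := oapp (c ord0) 0 (insub k : option 'I_M).
have half0 k : 0 <= 2^-1 ^+ k :> K by rewrite exprn_ge0 // invr_ge0.
have cle j : `|c ord0 j| <= D * C.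
  apply: le_trans (ler_mx_norm_coord _ _ _) _.
  by apply: le_trans (hD _) _; rewrite ler_wpM2l.
have c'l (i : 'I_M) : c' (lshift m i) = c ord0 i by rewrite /c' /= valK.
have c'r (i : 'I_m) : c' (rshift M i) = 0.
  by rewrite /c' insubF //= ltnNge leq_addr.
have c'le k : - (D * C) <= c' k /\ c' k <= D * C.
  rewrite /c'; case: insubP => [j _ _|_] /=; last by have := mulr_ge0 D0 C0; lra.
  by have := cle j; rewrite ler_norml => /andP.
have sum2 j : \sum_(k < j) 2^-1 ^+ k.+1 = 1 - 2^-1 ^+ j :> K.
  elim: j => [|j IH]; first by rewrite big_ord0 subrr.
  by rewrite big_ord_recr /= IH exprS; lra.
(* For [k < M] the weight is nonnegative because [2^-(k+1) >= 2^-M >= 2^-N D C]. The series and the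
   tail each contribute at most 1 to the total. *)
exists N, (fun k => if (k < N)%N then 2^-1 ^+ k.+1 + 2^-1 ^+ N * c' k else 0).
split.
- move=> k; case: ifP => // kN; have [h1 _] := c'le k.
  have [kM|Mk] := ltnP k M; last by rewrite /c' insubF ?mulr0 ?addr0 //; lia.
  have h2 : 2^-1 ^+ M <= 2^-1 ^+ k.+1 :> K.
    by rewrite ler_wiXn2l // ?invr_ge0 // invf_le1 // ler1n.
  have h3 : 2^-1 ^+ m * (D * C) <= 1.
    apply: le_trans (ltW hm); rewrite ler_wpM2l // lerDr.
    by rewrite !mulr_ge0.
  have h4 : 2^-1 ^+ N * - (D * C) <= 2^-1 ^+ N * c' k by rewrite ler_wpM2l.
  have h5 : 2^-1 ^+ M * (2^-1 ^+ m * (D * C)) <= 2^-1 ^+ M * 1.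
    by rewrite ler_wpM2l.
  move: h4 h5 h2; rewrite /N exprD mulr1; nra.
- under eq_bigr => k _ do rewrite ltn_ord.
  rewrite big_split /= sum2 -mulr_sumr big_split_ord /=.
  rewrite [X in _ * (_ + X)]big1 ?addr0; last by move=> i _; exact: c'r.
  have hs : \sum_(i < M) c' i <= M%:R * (D * C).
    rewrite mulr_natl -[X in _ *+ X]card_ord -sumr_const.
    by apply: ler_sum => i _; case: (c'le i).
  have h4 : 2^-1 ^+ N * (\sum_(i < M) c' i) <= 2^-1 ^+ N * (M%:R * (D * C)).
    by rewrite ler_wpM2l.
  have h5 : 2^-1 ^+ N * (M%:R * (D * C)) <= 2^-1 ^+ m * (M%:R * (D * C)).
    rewrite ler_wpM2r ?mulr_ge0 // ler_wiXn2l ?leq_addl // ?invr_ge0 //.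
    by rewrite invf_le1 // ler1n.
  have h6 : 0 <= 2^-1 ^+ m * (D * C) by rewrite !mulr_ge0.
  move: h4 h5 h6 hm (half0 N); rewrite mulrDr; lra.
- rewrite (midpoint_orbit_unfold N hf).
  under [RHS]eq_bigr => k _ do rewrite ltn_ord scalerDl -scalerA.
  rewrite big_split /=; congr (_ + _); rewrite -scaler_sumr; congr (_ *: _).
  rewrite big_split_ord /= [X in _ = _ + X]big1 ?addr0; last first.
    by move=> i _; rewrite c'r scale0r.
  rewrite -[LHS](mulmxKpV (fB N)) -/c mulmx_sum_row.
  by apply: eq_bigr => i _; rewrite c'l rowK.
Qed.

(* Infinite convex combinations with weights [2^-(k+1)] stay in [A] although [A]
   need not be closed. *)
Lemma midpoint_orbit_mem (K : realType) (n : nat) (A : set 'rV[K]_n) (C : K)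
    (a e : nat -> 'rV[K]_n) :
  unit_interval_convex A -> (forall k, A (a k)) ->
  (forall k, e k = 2^-1 *: (a k + e k.+1)) -> (forall k, `|e k| <= C) ->
  A (e 0%N).
Proof.
move=> cA Aa he eC; set p := a 0%N.
(* Since [e 0 - p = (e 1 - p) / 2], the total weight 2 allowed for [f 0] becomes 1, and [p] takes
   the rest. *)
pose v k := a k.+1 - p; pose f k := e k.+1 - p.
have hf k : f k = 2^-1 *: (v k + f k.+1).
  by rewrite /f he /v; apply/rowP => j; rewrite !mxE; lra.
have [k|N [w [w0 w2 fE]]] := @midpoint_orbit_finite_sum _ _ (C + `|p|) v f hf.
  by apply: le_trans (ler_normB _ _) _; rewrite lerD2r.
have -> : e 0%N = p + \sum_(k < N) (2^-1 * w k) *: (a k.+1 - p).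
  under eq_bigr => k _ do rewrite -scalerA.
  rewrite -scaler_sumr -fE he -/p /f.
  by apply/rowP => j; rewrite !mxE; lra.
apply: (@convex_subcombination _ _ _ p (fun k => a k.+1)
    (fun k => 2^-1 * w k) N cA (Aa 0%N) (fun k => Aa k.+1)) => [k|].
  by rewrite mulr_ge0 // invr_ge0.
by rewrite -mulr_sumr; lra.
Qed.

(** * Continuity of the series *)

Lemma half_series_continuous (K : realType) (n : nat) (X : topologicalType)
    (a : X -> 'rV[K]_n) (t : X -> X) (N : nat) :
  continuous a -> continuous t -> continuous (half_series a t N).
Proof.
move=> ca ct; elim: N => [|N IH] x /=; first exact: cvg_cst.
apply: cvgZr; apply: cvgD; first exact: ca.
exact: (@continuous_comp _ _ _ t (half_series a t N) x (ct x) (IH (t x))).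
Qed.

Lemma half_series_limit_continuous (K : realType) (n : nat)
    (X : topologicalType) (a l : X -> 'rV[K]_n) (t : X -> X) (C : K) :
  continuous a -> continuous t -> 0 <= C ->
  (forall N x, `|half_series a t N x - l x| <= 2^-1 ^+ N * C) -> continuous l.
Proof.
move=> ca ct C0 hl x; apply/cvgrPdist_lt => e e0.
have [N hN] := expr_half_lt C0 (divr_gt0 e0 (ltr0n K 3)).
have /cvgrPdist_lt/(_ _ (divr_gt0 e0 (ltr0n K 3))) :=
  @half_series_continuous _ _ _ _ _ N ca ct x.
apply: filterS => y hy.
have -> : l x - l y = (half_series a t N x - half_series a t N y)
   - (half_series a t N x - l x) + (half_series a t N y - l y).
  by apply/rowP => j; rewrite !mxE; ring.
apply: le_lt_trans (ler_normD _ _) _.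
have := ler_normB (half_series a t N x - half_series a t N y)
  (half_series a t N x - l x).
move: (hl N x) (hl N y) hN hy; lra.
Qed.

(** * Elementary forms of boundedness and convexity *)

Lemma bounded_setP (K : realType) (n : nat) (A : set 'rV[K]_n) :
  bounded_set A <-> exists C : K, forall x, A x -> `|x| <= C.
Proof.
split=> [/pinfty_ex_gt0[M _ hM]|[C hC]]; first by exists M.
rewrite /= /bounded_near; near=> M => x /hC /le_trans; apply.
by near: M; apply: nbhs_pinfty_ge; exact: num_real.
Unshelve. all: by end_near. Qed.

Lemma convex_set_unit_interval (K : realType) (n : nat) (A : set 'rV[K]_n) :
  convex_set (A : set (convex_lmodType 'rV[K]_n)) <-> unit_interval_convex A.
Proof.
split=> [cA x y s Ax Ay s0 s1|cA x y s]; last first.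
  by rewrite !inE => Ax Ay; apply: cA.
by have := cA x y (Itv01 s0 s1); rewrite !inE; apply.
Qed.

(** * Bounded convex sets are midpoint-convex bodies *)

Lemma continuous_set_val_comp (T X : topologicalType) (A : set T)
    (f : X -> A) :
  continuous (fun x => val (f x)) -> continuous f.
Proof. exact: (@continuous_comp_initial A X T set_val f). Qed.

Lemma set_val_continuous (T : topologicalType) (A : set T) :
  continuous (fun x : A => val x : T).
Proof. exact: initial_continuous. Qed.

Lemma Amid_midpoint_object (n : nat) (A : set 'rV[R]_n) (hA : mid_closed A) :
  midpoint_object (Amid hA).
Proof.
split.
- apply: continuous_set_val_comp => p /=; apply: cvgZr; apply: cvgD.
    apply: (@continuous_comp _ _ _ (@fst A A) (fun x : A => val x : 'rV[R]_n)).
      exact: cvg_fst.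
    exact: set_val_continuous.
  apply: (@continuous_comp _ _ _ (@snd A A) (fun x : A => val x : 'rV[R]_n)).
    exact: cvg_snd.
  exact: set_val_continuous.
- by move=> x; apply: val_inj; apply/rowP => j; rewrite /= !mxE; lra.
- by move=> x y; apply: val_inj; rewrite /= addrC.
- by move=> x y z w; apply: val_inj; apply/rowP => j; rewrite /= !mxE; lra.
Qed.

Lemma Amid_cancellative (n : nat) (A : set 'rV[R]_n) (hA : mid_closed A) :
  mid_cancellative (Amid hA).
Proof.
move=> x y z /(congr1 val) /= h; apply: val_inj.
have half_neq0 : (2^-1 : R) != 0 by rewrite invr_eq0 pnatr_eq0.
by move/(scalerI half_neq0)/addrI: h.
Qed.

Lemma Amid_iterative (n : nat) (A : set 'rV[R]_n) (hA : mid_closed A) (C : R) :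
  0 <= C -> (forall x, A x -> `|x| <= C) -> unit_interval_convex A ->
  mid_iterative (Amid hA).
Proof.
move=> C0 bA cA X c cc.
pose a x : 'rV[R]_n := val (c x).1; pose t x := (c x).2.
have ca : continuous a.
  move=> x; apply: (@continuous_comp _ _ _ (fun x => (c x).1)
    (fun y : A => val y : 'rV[R]_n)); last exact: set_val_continuous.
  by apply: (@continuous_comp _ _ _ c (@fst A X)); [exact: cc|exact: cvg_fst].
have ct : continuous t.
  move=> x; apply: (@continuous_comp _ _ _ c (@snd A X)); first exact: cc.
  exact: cvg_snd.
have valA (y : A) : A (val y) by apply: set_mem; exact: (valP y).
have aC x : `|a x| <= C by exact/bA/valA.
have [l [lE lC lS]] := half_series_limit t aC C0.
have lA x : l x \in A.
  apply: mem_set.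
  apply: (@midpoint_orbit_mem _ _ _ C (fun k => a (iter k t x))
    (fun k => l (iter k t x))) => // k.
  exact: valA.
exists (fun x => SigSub (lA x) : A); split.
  split; last by apply: funext => x; apply: val_inj; exact: lE.
  apply: continuous_set_val_comp => /=.
  exact: half_series_limit_continuous ca ct C0 lS.
move=> u' [_ u'E]; apply: funext => x; apply: val_inj => /=.
apply: subr0_eq.
(* Uniqueness: along the [t]-orbit of [x], the difference of two solutions is a bounded halving
   orbit. *)
apply: (@half_orbit_eq0 _ _ (C + C)
  (fun k => l (iter k t x) - val (u' (iter k t x)))) => k.
  rewrite {1}lE {1}u'E /=.
  by apply/rowP => j; rewrite !mxE /a /t; lra.
by apply: le_trans (ler_normB _ _) _; rewrite lerD // bA.
Qed.

(** * Iterativity forces boundedness and convexity *)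

Lemma cvg_ptws_agree_prefix (T : uniformType) (s : nat -> {ptws nat -> T})
    (p : {ptws nat -> T}) :
  (forall N k, (k < N)%N -> s N k = p k) -> s @ \oo --> p.
Proof.
move=> sp; apply/(pointwise_cvgP p) => k.
apply: cvg_near_cst.
have : \forall N \near \oo, s N k = p k.
  by exists k.+1 => // N /= kN; exact: sp.
exact.
Qed.

Lemma shift_continuous (T : topologicalType) :
  continuous ((fun a k => a k.+1) : {ptws nat -> T} -> {ptws nat -> T}).
Proof.
move=> a; apply/cvg_sup; first exact/fmap_filter/nbhs_filter.
move=> k U [V] [[W] oW <-] Wa WU.
apply: (filterS WU); first exact/fmap_filter/nbhs_filter.
exact: (@proj_continuous nat (fun=> T) k.+1 a W (open_nbhs_nbhs (conj oW Wa))).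
Qed.

Lemma mid_iterative_sequences (n : nat) (A : set 'rV[R]_n)
    (hA : mid_closed A) :
  mid_iterative (Amid hA) ->
  exists2 u : {ptws nat -> A} -> A, continuous u &
    forall a, u a = Amid hA (a 0%N) (u (fun k => a k.+1)).
Proof.
move=> /(_ {ptws nat -> A} (fun a => (a 0%N, fun k => a k.+1))).
case=> [a|u [[cu uE] _]]; last by exists u => // a; rewrite {1}uE.
have h0 := @proj_continuous nat (fun=> A) 0%N a.
have h2 := cvg_pair h0 (@shift_continuous A a).
exact (h2 (nbhs_filter (a : {ptws nat -> A})) (nbhs_filter (a 0%N : A))
  (nbhs_filter ((fun k => a k.+1) : {ptws nat -> A}))).
Qed.

Lemma mid_iterative_bounded (n : nat) (A : set 'rV[R]_n) (hA : mid_closed A) :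
  A !=set0 -> mid_iterative (Amid hA) ->
  exists C : R, forall x, A x -> `|x| <= C.
Proof.
move=> [p0 Ap0] /mid_iterative_sequences[u cu uE].
pose p : A := SigSub (mem_set Ap0).
have [//|unb] := pselect (exists C : R, forall x, A x -> `|x| <= C).
(* The distance [2^N] cancels the factor [2^-N] in [zE], keeping [u (z N (b N))] at distance at
   least 1 from [p]. *)
have far N : exists b : A, 2 ^+ N <= `|val b - val p|.
  apply: contrapT => hN; apply: unb; exists (2 ^+ N + `|val p|) => x Ax.
  rewrite leNgt; apply/negP => hx; apply: hN.
  exists (SigSub (mem_set Ax)) => /=.
  have := ler_normD (x - p0) p0; rewrite subrK.
  by move: hx => /=; lra.
have [b bfar] := choice far.
pose z N (q : A) : {ptws nat -> A} := fun k => if (k < N)%N then p else q.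
have zE N q : val (u (z N q)) - val p = 2^-1 ^+ N *: (val q - val p).
  (* For [N = 0] the sequence is constantly [q], and [h = (q + h) / 2] forces [h = q]. Each
     prepended [p] halves the distance to [p]. *)
  elim: N => [|N IH].
    have : val (u (z 0%N q)) = 2^-1 *: (val q + val (u (z 0%N q))).
      by rewrite {1}uE.
    rewrite expr0 scale1r => h; congr (_ - _).
    apply/rowP => j; move/rowP/(_ j): h; rewrite !mxE; lra.
  rewrite uE /=.
  have -> : (fun k => z N.+1 q k.+1) = z N q by [].
  rewrite exprS -scalerA -IH.
  by apply/rowP => j; rewrite !mxE; lra.
have cz : (fun N => z N (b N)) @ \oo --> ((fun=> p) : {ptws nat -> A}).
  by apply: cvg_ptws_agree_prefix => N k kN; rewrite /z kN.
have up : val (u (fun=> p)) = val p.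
  have /eqP := zE 0%N p; rewrite subrr scaler0 subr_eq0 => /eqP <-.
  by congr (val (u _)); apply: funext => k.
have cuz : (fun N => val (u (z N (b N))) : 'rV[R]_n) @ \oo --> val p.
  rewrite -up.
  apply: (cvg_comp _ (fun a => val (u a) : 'rV[R]_n) cz).
  apply: (@continuous_comp _ _ _ u (fun y : A => val y : 'rV[R]_n)).
    exact: cu.
  exact: set_val_continuous.
have /cvgrPdist_lt/(_ 1 ltr01)[N _ /(_ N (leqnn N))] := cuz.
rewrite /= distrC zE normrZ ger0_norm ?exprn_ge0 ?invr_ge0 // exprVn.
by rewrite mulrC ltr_pdivrMr ?exprn_gt0 // mul1r ltNge bfar.
Qed.

Lemma mid_iterative_convex (n : nat) (A : set 'rV[R]_n) (hA : mid_closed A)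
    (C : R) :
  (forall x, A x -> `|x| <= C) -> mid_iterative (Amid hA) ->
  unit_interval_convex A.
Proof.
move=> bA /mid_iterative_sequences[u _ uE] x y s Ax Ay s0 s1.
have valA (q : A) : A (val q) by apply: set_mem; exact: (valP q).
pose X : A := SigSub (mem_set Ax); pose Y : A := SigSub (mem_set Ay).
(* [double] drops the leading binary digit of [r], and [X] stands for the digit 1. As
   [double 1 = 1], the number 1 is read as 0.111... and the unit interval is stable. *)
pose double (r : R) := if 2^-1 <= r then 2 * r - 1 else 2 * r.
pose digits r : {ptws nat -> A} :=
  fun k => if 2^-1 <= iter k double r then X else Y.
have r01 k : 0 <= iter k double s <= 1.
  elim: k => [|k]; first by rewrite s0 s1.
  rewrite iterS; move: (iter k double s) => r /andP[r0 r1]; rewrite /double.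
  by apply/andP; case: ifPn; rewrite -?ltNge => h; split; lra.
suff /eqP : val (u (digits s)) - (s *: x + (1 - s) *: y) = 0.
  by rewrite subr_eq0 => /eqP <-; exact: valA.
(* Both [u (digits r)] and [r x + (1 - r) y] are the midpoint of the leading digit's point and their
   own value at [double r]. The first is bounded by [C], the second by [C + C]. *)
apply: (@half_orbit_eq0 _ _ (C + (C + C)) (fun k => let r := iter k double s in
  val (u (digits r)) - (r *: x + (1 - r) *: y) : 'rV[R]_n)) => k /=.
  have -> : digits (double (iter k double s)) =
      fun j => digits (iter k double s) j.+1.
    by apply: funext => j; rewrite /digits iterSr.
  rewrite {1}uE /= {1}/digits /=.
  move: (val (u _)) => w; rewrite /double.
  by case: ifP => _; apply/rowP => j; rewrite !mxE /=; field.
have /andP[] := r01 k; move: (iter k double s) => r r0 r1.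
have scaleC (q : 'rV[R]_n) : A q -> forall c : R, 0 <= c -> c <= 1 ->
    c * `|q| <= C.
  move=> /bA qC c c0 c1; apply: le_trans qC.
  by rewrite ler_piMl.
apply: le_trans (ler_normB _ _) _; rewrite lerD //; first exact/bA/valA.
apply: le_trans (ler_normD _ _) _; rewrite !normrZ !ger0_norm ?subr_ge0 //.
by rewrite lerD // scaleC // ?subr_ge0 // gerBl.
Qed.

Theorem mainTheorem17 (n : nat) (A : set 'rV[R]_n) (hA : mid_closed A) :
  A !=set0 ->
  (midpoint_convex_body (Amid hA) <->
   bounded_set A /\ convex_set (A : set (convex_lmodType 'rV[R]_n))).
Proof.
move=> A0; split=> [[_ _ iA]|[/bounded_setP[C bA] /convex_set_unit_interval cA]].
  have [C bA] := mid_iterative_bounded A0 iA.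
  split; first by apply/bounded_setP; exists C.
  by apply/convex_set_unit_interval; exact: mid_iterative_convex bA iA.
have C0 : 0 <= C by case: A0 => x /bA; exact: le_trans.
split; [exact: Amid_midpoint_object|exact: Amid_cancellative|].
exact: Amid_iterative C0 bA cA.
Qed.
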